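(* Let $M\subset\mathbb R^n$ be a complete Riemannian submanifold of $\mathbb R^n$ (of class at least $C^2$) with the induced metric, and let $S\subset M$ be a nonempty closed set. If $S$ is prox-regular as a subset of the Riemannian manifold $M$, then $S$ is prox-regular as a subset of $\mathbb R^n$.
   Context: $S$ is a nonempty closed subset of $M$, also regarded as a closed subset of $\mathbb R^n$. Let $N$ be a Riemannian manifold (here $N=M$ with the induced metric, or $N=\mathbb R^n$ with the Euclidean metric, in which case $\exp_x^{-1}y=y-x$), with Riemannian distance $d$. A convex set is a set in which any two points are joined by a unique minimizing geodesic of $N$, which lies in the set; then $\exp_x^{-1}y$ denotes the initial velocity at $x$ of the minimizing geodesic $[0,1]\to N$ from $x$ to $y$. Proximal normal cone: for $S\subseteq N$ closed and $x\in S$, $\xi\in T_xN$ is a proximal normal to $S$ at $x$ iff there exist $\sigma>0$ and a convex neighborhood $U$ of $x$ in $N$ with $\langle\xi,\exp_x^{-1}y\rangle\le\sigma d^2(x,y)$ for all $y\in U\cap S$. Prox-regularity: a closed set $S\subseteq N$ is prox-regular at $\bar x\in S$ if there exist $\varepsilon>0,\sigma>0$ such that $B(\bar x,\varepsilon)$ is convex and $\langle v,\exp_x^{-1}y\rangle\le\sigma d^2(x,y)$ for all $x,y\in S\cap B(\bar x,\varepsilon)$ and all proximal normals $v$ to $S$ at $x$ with $\|v\|<\varepsilon$. $S$ is prox-regular if it is so at each of its points. *)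

(* Defs.v *)
From mathcomp Require Import all_boot all_order all_algebra.
From mathcomp Require Import all_classical all_reals all_analysis.

Set Implicit Arguments.
Unset Strict Implicit.
Unset Printing Implicit Defensive.

Import Order.TTheory GRing.Theory Num.Theory.
Import numFieldNormedType.Exports.

Local Open Scope classical_set_scope.
Local Open Scope ring_scope.

(* R^n is 'rV[R]_n.  The library norm on 'rV[R]_n is the sup norm, which is used
   here only for the topology and for differentiability; lengths are measured
   with the Euclidean norm [enorm]. *)

Definition dot (R : realType) (n : nat) (u v : 'rV[R]_n) : R :=
  \sum_(i < n) u 0 i * v 0 i.

Definition enorm (R : realType) (n : nat) (u : 'rV[R]_n) : R :=
  Num.sqrt (dot u u).

(* [f] is of class C^m on [A]; meant for [A] open. *)
Fixpoint Ck (R : realType) (E F : normedModType R) (m : nat) (A : set E)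
    (f : E -> F) {struct m} : Prop :=
  match m with
  | 0%N => forall x, A x -> {for x, continuous f}
  | m'.+1 => (forall x, A x -> differentiable f x) /\
             (forall v : E, Ck m' A (fun x => 'D_v f x))
  end.

(* Curves are functions on the whole line, of which only the restriction to
   [0, 1] matters.  A C^m curve on a closed interval (one-sided derivatives at
   the end points) is the restriction of a C^m curve defined on R, so requiring
   regularity on R loses nothing. *)
Definition Ck_curve (R : realType) (n m : nat) (c : R -> 'rV[R]_n) : Prop :=
  @Ck R (R^o : normedModType R) ('rV[R]_n : normedModType R) m setT c.

(* Embedded submanifolds of class C^2, by slice charts: near each of its points,
   M is carried by a C^2 diffeomorphism [f : U -> V] between open sets of R^n,
   with inverse [g], onto the part of V lying in R^k x {0}. *)
Definition submanifold (R : realType) (n k : nat) (M : set 'rV[R]_n) : Prop :=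
  (k <= n)%N /\
  forall p, M p ->
    exists (U V : set 'rV[R]_n) (f g : 'rV[R]_n -> 'rV[R]_n),
      [/\ [/\ open U, open V & U p],
          Ck 2 U f /\ Ck 2 V g,
          forall x, U x -> V (f x) /\ g (f x) = x,
          forall z, V z -> U (g z) /\ f (g z) = z &
          forall x, U x ->
            (M x <-> forall i : 'I_n, (k <= i)%N -> f x 0 i = 0)].

Section InducedGeometry.
Variables (R : realType) (n : nat).
Implicit Types (M S U : set 'rV[R]_n) (x y v : 'rV[R]_n) (c : R -> 'rV[R]_n).

Definition tangent M x : set 'rV[R]_n :=
  [set v | exists c, [/\ Ck_curve 1 c, \forall t \near (0 : R), M (c t),
                         c 0 = x & derive1 c 0 = v]].

Definition piecewise_C1 c : Prop :=
  exists s : seq R, itv_partition 0 1 s /\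
    forall i, (i < size s)%N -> exists g, Ck_curve 1 g /\
      forall t, nth 0 (0 :: s) i <= t <= nth 0 s i -> c t = g t.

(* For a piecewise C^1 curve, [derive1 c] is the velocity except at finitely many
   points, which do not affect the integral. *)
Definition curve_length c : \bar R :=
  (\int[lebesgue_measure]_(t in `[0%R, 1%R]) (enorm (derive1 c t))%:E)%E.

(* The Riemannian distance of the metric induced on M; it is +oo between
   different connected components, M not being assumed connected. *)
Definition rdist M x y : \bar R :=
  ereal_inf [set curve_length c | c in
    [set c | [/\ piecewise_C1 c, forall t, 0 <= t <= 1 -> M (c t),
                 c 0 = x & c 1 = y]]].

Definition rball M x (e : R) : set 'rV[R]_n :=
  [set y | M y /\ (rdist M x y < e%:E)%E].

Definition complete_submanifold M : Prop :=
  forall u : nat -> 'rV[R]_n, (forall i, M (u i)) ->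
    (forall e : R, 0 < e -> exists N, forall i j, (N <= i)%N -> (N <= j)%N ->
       (rdist M (u i) (u j) < e%:E)%E) ->
    exists x, M x /\
      forall e : R, 0 < e -> exists N, forall i, (N <= i)%N ->
        (rdist M (u i) x < e%:E)%E.

(* The covariant derivative of the induced metric is the tangential part of the
   derivative in R^n, so a geodesic is a C^2 curve in M whose acceleration is
   normal to M. *)
Definition geodesic M c : Prop :=
  [/\ Ck_curve 2 c, forall t, 0 <= t <= 1 -> M (c t) &
      forall t, 0 <= t <= 1 ->
        forall v, tangent M (c t) v -> dot (derive1 (derive1 c) t) v = 0].

Definition min_geodesic M x y c : Prop :=
  [/\ geodesic M c, c 0 = x, c 1 = y & curve_length c = rdist M x y].

Definition convex M U : Prop :=
  U `<=` M /\
  forall x y, U x -> U y ->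
    exists c, [/\ min_geodesic M x y c,
      forall c', min_geodesic M x y c' -> forall t, 0 <= t <= 1 -> c' t = c t &
      forall t, 0 <= t <= 1 -> U (c t)].

(* exp_x^{-1} y; meaningful when x and y lie in a common convex set. *)
Definition inv_exp M x y : 'rV[R]_n :=
  xget 0 [set v | exists c, min_geodesic M x y c /\ derive1 c 0 = v].

Definition proximal_normal M S x v : Prop :=
  tangent M x v /\
  exists (s : R) U,
    [/\ 0 < s, convex M U, U x, within M (nbhs x) U &
        forall y, U y -> S y ->
          ((dot v (inv_exp M x y))%:E <= s%:E * rdist M x y ^+ 2)%E].

Definition prox_regular_at M S x0 : Prop :=
  exists e s : R,
    [/\ 0 < e, 0 < s, convex M (rball M x0 e) &
        forall x y v, S x -> rball M x0 e x -> S y -> rball M x0 e y ->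
          proximal_normal M S x v -> enorm v < e ->
          ((dot v (inv_exp M x y))%:E <= s%:E * rdist M x y ^+ 2)%E].

(* [S] is prox-regular as a subset of the Riemannian manifold [M]; with
   [M := setT] this is prox-regularity in Euclidean space. *)
Definition prox_regular M S : Prop := forall x, S x -> prox_regular_at M S x.

Definition closed_in M S : Prop := exists2 C, closed C & S = M `&` C.

End InducedGeometry.

(* Main.v *)
Require Import Defs.
From mathcomp Require Import all_boot all_order all_algebra.
From mathcomp Require Import all_classical all_reals all_analysis.
From mathcomp Require Import measurable_realfun ring lra.

Set Implicit Arguments.
Unset Strict Implicit.
Unset Printing Implicit Defensive.

Import Order.TTheory GRing.Theory Num.Theory.
Import numFieldNormedType.Exports.

Local Open Scope classical_set_scope.
Local Open Scope ring_scope.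

(** Prox-regularity in [M] bounds pairings with [w = exp_x^{-1} y], the initial
velocity of the minimizing geodesic [c] of [M] from [x] to [y]; prox-regularity in
Euclidean space bounds pairings with the chord [y - x].  Since
[y - x - w = c(1) - c(0) - c'(0)], Taylor's formula makes the difference quadratic:
if [|c''| <= K |c'|^2] along [c], then [|<v, y - x> - <v, w>| <= |v| K |w|^2], and
[|w| = d_M(x, y)] because geodesics have constant speed ([geodesic_dot_bounds]).

Near a point of [M] three facts hold uniformly ([submanifold_local_geometry]).
First, [d_M(p, q) <= C |p - q|]: pull the segment between the chart images of [p]
and [q] back to [M].  Second, [|c''| <= K |c'|^2] for short geodesics, which is a
bound on the second fundamental form.  It only takes a locally Lipschitz differential
of the inverse chart: [c'(s) - c'(t)] is, up to a tangent vector at [c(t)], the increment of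
that differential along [c], hence of size [O(|s - t| |c'|^2)],
and [c''(t)] is orthogonal to the tangent vectors.  Third, the tangent space is the
row space of a matrix, so every [v] has an orthogonal projection [vT] on it
([orthogonal_projection]).

Let [v] be a Euclidean proximal normal to [S] at [x].  As [w] is tangent,
[<vT, w> = <v, w>], and the Taylor estimate with [|x - y| <= d_M(x, y)] shows that
[vT] is a proximal normal to [S] in [M]; the geodesic ball of the hypothesis is the
convex neighbourhood required for this ([tangential_part_proximal]).  Moreover
[|vT| <= |v|], so the hypothesis gives [<v, w> = <vT, w> <= s d_M(x, y)^2] with a
uniform [s], and the Taylor estimate together with [d_M(x, y) <= C |x - y|] turns
this into [<v, y - x> <= (s + e K) C^2 |x - y|^2].

The Euclidean notions are made explicit on the way: [d(x, y) = |x - y|] needs the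
fundamental theorem of calculus along piecewise [C^1] curves
([enorm_le_curve_length]), and geodesics of the whole space are affine
([geodesic_setT]), so that [exp_x^{-1} y = y - x]. *)

(** * The Euclidean inner product and norm *)

Section EuclideanNorm.
Variables (R : realType) (n : nat).
Implicit Types (u v w : 'rV[R]_n) (a : R).

Lemma dotC u v : dot u v = dot v u.
Proof. by apply: eq_bigr => i _; rewrite mulrC. Qed.

Lemma dotDl u v w : dot (u + v) w = dot u w + dot v w.
Proof. by rewrite -big_split; apply: eq_bigr => i _; rewrite mxE mulrDl. Qed.

Lemma dotZl a u v : dot (a *: u) v = a * dot u v.
Proof. by rewrite mulr_sumr; apply: eq_bigr => i _; rewrite mxE mulrA. Qed.

Lemma dotNl u v : dot (- u) v = - dot u v.
Proof. by rewrite -scaleN1r dotZl mulN1r. Qed.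

Lemma dotBl u v w : dot (u - v) w = dot u w - dot v w.
Proof. by rewrite dotDl dotNl. Qed.

Lemma dot0l u : dot 0 u = 0.
Proof. by rewrite -(scale0r 0) dotZl mul0r. Qed.

Lemma dotDr u v w : dot u (v + w) = dot u v + dot u w.
Proof. by rewrite !(dotC u) dotDl. Qed.

Lemma dotZr a u v : dot u (a *: v) = a * dot u v.
Proof. by rewrite !(dotC u) dotZl. Qed.

Lemma dotBr u v w : dot u (v - w) = dot u v - dot u w.
Proof. by rewrite !(dotC u) dotBl. Qed.

Lemma dot_ge0 u : 0 <= dot u u.
Proof. by apply: sumr_ge0 => i _; rewrite -expr2 sqr_ge0. Qed.

Lemma dot_eq0 u : dot u u = 0 -> u = 0.
Proof.
move=> /eqP; rewrite psumr_eq0 => [/allP u0|i _]; last by rewrite -expr2 sqr_ge0.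
apply/rowP => i; rewrite mxE; apply/eqP.
by have := u0 i (mem_index_enum i); rewrite mulf_eq0 orbb.
Qed.

Lemma enorm_ge0 u : 0 <= enorm u.
Proof. exact: sqrtr_ge0. Qed.

Lemma sqr_enorm u : enorm u ^+ 2 = dot u u.
Proof. by rewrite sqr_sqrtr// dot_ge0. Qed.

Lemma enorm0 : enorm (0 : 'rV[R]_n) = 0.
Proof. by rewrite /enorm dot0l sqrtr0. Qed.

Lemma enorm_eq0 u : enorm u = 0 -> u = 0.
Proof. by move=> u0; apply: dot_eq0; rewrite -sqr_enorm u0 expr0n. Qed.

Lemma enormZ a u : enorm (a *: u) = `|a| * enorm u.
Proof.
by rewrite /enorm dotZl dotZr mulrA -expr2 sqrtrM ?sqr_ge0// sqrtr_sqr.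
Qed.

Lemma enormN u : enorm (- u) = enorm u.
Proof. by rewrite -scaleN1r enormZ normrN1 mul1r. Qed.

(** [| |v| u - |u| v |^2 >= 0] expands to [2 |u| |v| (|u| |v| - <u, v>) >= 0]. *)
Lemma cauchy_schwarz u v : dot u v <= enorm u * enorm v.
Proof.
have [u0|u0] := eqVneq (enorm u) 0.
  by rewrite u0 (enorm_eq0 u0) dot0l mul0r.
have [v0|v0] := eqVneq (enorm v) 0.
  by rewrite v0 (enorm_eq0 v0) dotC dot0l mulr0.
have up : 0 < enorm u by rewrite lt_neqAle eq_sym u0 enorm_ge0.
have vp : 0 < enorm v by rewrite lt_neqAle eq_sym v0 enorm_ge0.
have := dot_ge0 (enorm v *: u - enorm u *: v).
rewrite dotBl !dotBr !dotZl !dotZr -!sqr_enorm (dotC v u).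
have : 0 < enorm u * enorm v by exact: mulr_gt0.
set a := enorm u; set b := enorm v => ab.
have -> : b * (b * a ^+ 2) - b * (a * dot u v) - (a * (b * dot u v) - a * (a * b ^+ 2))
  = 2 * (a * b) * (a * b - dot u v) by ring.
by rewrite pmulr_rge0 ?subr_ge0// mulr_gt0.
Qed.

Lemma cauchy_schwarz_norm u v : `|dot u v| <= enorm u * enorm v.
Proof.
by rewrite ler_norml cauchy_schwarz andbT lerNl -dotNl -(enormN u) cauchy_schwarz.
Qed.

Lemma enormD u v : enorm (u + v) <= enorm u + enorm v.
Proof.
rewrite -(@ler_pXn2r _ 2)// ?nnegrE ?addr_ge0 ?enorm_ge0//.
rewrite sqrrD !sqr_enorm dotDl !dotDr (dotC v u).
by have := cauchy_schwarz u v; lra.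
Qed.

(** Norms are estimated by pairing a vector with itself, which turns the mean value
theorem for real functions into one for curves. *)
Lemma enorm_le_dot u a : 0 <= a -> dot u u <= enorm u * a -> enorm u <= a.
Proof.
move=> a0; rewrite -sqr_enorm expr2; have [->//|u0] := eqVneq (enorm u) 0.
by rewrite ler_pM2l// lt_neqAle eq_sym u0 enorm_ge0.
Qed.

(** The topology and differentiability come from the sup norm [`|u|], lengths from
[enorm]; the next two lemmas let estimates pass from one to the other. *)
Lemma norm_le_enorm u : `|u| <= enorm u.
Proof.
rewrite [leLHS]/Num.Def.normr/= mx_normrE bigmax_le ?enorm_ge0// => -[i j] _ /=.
rewrite ord1 -sqrtr_sqr ler_wsqrtr// /dot (bigD1 j)//= -expr2 lerDl.
by apply: sumr_ge0 => k _; rewrite -expr2 sqr_ge0.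
Qed.

Lemma enorm_le_norm u : enorm u <= n%:R * `|u|.
Proof.
rewrite -(@ler_pXn2r _ 2)// ?nnegrE ?mulr_ge0 ?enorm_ge0// sqr_enorm.
have ui i : `|u 0 i| <= `|u|.
  rewrite [leRHS]/Num.Def.normr/= mx_normrE.
  exact: (le_bigmax _ (fun ij => `|u ij.1 ij.2|) (0, i)).
apply: (@le_trans _ _ (\sum_(i < n) `|u| ^+ 2)).
  apply: ler_sum => i _; rewrite -expr2 -real_normK ?num_real//.
  by rewrite ler_pXn2r// ?nnegrE.
rewrite sumr_const card_ord -[leLHS]mulr_natl exprMn ler_wpM2r ?sqr_ge0//.
by rewrite -natrX ler_nat -mulnn; case: (n) => // m; exact: leq_pmulr.
Qed.

End EuclideanNorm.

(** * Calculus of curves *)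

Section Curves.
Variables (R : realType) (n : nat).
Implicit Types (u v : 'rV[R]_n) (c : R -> 'rV[R]_n) (t : R).

Lemma derive1_funE c : derive1 c = 'D_(1 : R^o) c.
Proof. by apply/funext => t; rewrite derive1E. Qed.

(** On the line the differential is determined by its value at [1], so that
regularity of curves can be stated with [derive1] alone. *)
Lemma Ck1_curveP c :
  Ck_curve 1 c <-> (forall t, derivable c t 1) /\ continuous (derive1 c).
Proof.
rewrite /Ck_curve /=; split=> [[dc cc]|[dc cc]]; split.
- by move=> t; exact: diff_derivable (dc t I).
- by rewrite derive1_funE => t; exact: cc.
- by move=> t _; apply/derivable1_diffP; exact: dc.
- move=> v t _.
  have -> : (fun x : R^o => 'D_v c x) = (fun s => v *: derive1 c s).
    apply/funext => s; rewrite deriveE; last exact/derivable1_diffP.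
    by rewrite deriv1E.
  by apply: continuousZr => //; exact: cc.
Qed.

Lemma Ck2_curve c : Ck_curve 2 c -> Ck_curve 1 c /\ Ck_curve 1 (derive1 c).
Proof.
move=> [dc cc].
have c1 : Ck_curve 1 (derive1 c) by rewrite derive1_funE; exact: cc.
split; last exact: c1.
apply/Ck1_curveP; split.
  by move=> t; exact: diff_derivable (dc t I).
move=> t; apply: differentiable_continuous.
by case: c1 => + _; apply.
Qed.

Lemma is_derive_dot u c t : derivable c t 1 ->
  is_derive t 1 (fun s => dot u (c s)) (dot u (derive1 c t)).
Proof.
move=> dc; rewrite /dot.
rewrite (_ : (fun s => _) = \sum_(i < n) (fun s => u 0 i * c s 0 i)); last first.
  by apply/funext => s; rewrite fct_sumE.
apply: is_derive_sum => i.
rewrite derive1E derive_mx// mxE.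
have dci : derivable (fun s => c s 0 i) t 1 by have /derivable_mxP := dc; apply.
have := @is_deriveZ _ _ _ (fun s => c s 0 i) (u 0 i) t 1 _ (derivableP dci).
done.
Qed.

Lemma is_derive_coord c t i : derivable c t 1 ->
  is_derive t 1 (fun s => c s 0 i) (derive1 c t 0 i).
Proof.
move=> dc; rewrite derive1E derive_mx// mxE; apply: derivableP.
by have /derivable_mxP := dc; apply.
Qed.

Lemma is_derive_sqspeed c t : derivable c t 1 ->
  is_derive t 1 (fun s => dot (c s) (c s)) (2 * dot (c t) (derive1 c t)).
Proof.
move=> dc.
have -> : 2 * dot (c t) (derive1 c t) =
    \sum_(i < n) (c t 0 i *: derive1 c t 0 i + c t 0 i *: derive1 c t 0 i).
  by rewrite mulr_sumr; apply: eq_bigr => i _; rewrite mulr_natl mulr2n.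
rewrite /dot.
rewrite (_ : (fun s => _) = \sum_(i < n) ((fun s => c s 0 i) * (fun s => c s 0 i)));
  last by apply/funext => s; rewrite fct_sumE.
apply: is_derive_sum => i; apply: is_deriveM; exact: is_derive_coord.
Qed.

(** The mean value theorem fails for vector-valued curves; it holds for their
component along a fixed vector. *)
Lemma dot_mvt u c a b : (forall t, derivable c t 1) -> a < b ->
  exists2 t, a < t < b & dot u (c b - c a) = dot u (derive1 c t) * (b - a).
Proof.
move=> dc ab.
have [t tab e] : exists2 t, t \in `]a, b[ &
    dot u (c b) - dot u (c a) = dot u (derive1 c t) * (b - a).
  apply: (@MVT _ (fun s => dot u (c s)) (fun s => dot u (derive1 c s))) => //.
    by move=> t _; exact: is_derive_dot.
  apply: derivable_within_continuous => t _.
  by have [] := is_derive_dot u (dc t).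
by exists t; [move: tab; rewrite in_itv|rewrite dotBr].
Qed.

Lemma is_derive_chain (U V : normedModType R) (h : U -> V) (c : R -> U) t :
  derivable c t 1 -> differentiable h (c t) ->
  is_derive t 1 (h \o c) ('d h (c t) (derive1 c t)).
Proof.
move=> /derivable1_diffP dc dh.
have dhc : differentiable (h \o c) t by exact: differentiable_comp.
apply: DeriveDef; first exact/derivable1_diffP.
by rewrite deriveE// diff_comp//= derive1E'.
Qed.

Lemma continuous_dot u : continuous (dot u).
Proof.
move=> v; apply: differentiable_continuous.
have -> : dot u = \sum_(i < n) (u 0 i *: (fun w : 'rV[R]_n => w 0 i)).
  by apply/funext => w; rewrite fct_sumE.
apply: differentiable_sum => i; apply: differentiableZ.
exact: differentiable_coord.
Qed.

Lemma continuous_enorm : continuous (@enorm R n).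
Proof.
move=> u; apply/(@cvgrPdist_le _ _ _ _ (nbhs_filter u)) => e e0.
have n1 : 0 < n%:R + 1 :> R by rewrite ltr_wpDl.
apply: filterS (nbhsx_ballx u _ (divr_gt0 e0 n1)) => v.
rewrite -ball_normE /= => /ltW uv.
have h : `|enorm u - enorm v| <= enorm (u - v).
  rewrite ler_norml; apply/andP; split.
    rewrite lerNl opprB lerBlDr -(enormN (u - v)) opprB.
    by rewrite -{1}(subrK u v) enormD.
  by rewrite lerBlDr -{1}(subrK v u) enormD.
apply: (le_trans h); apply: (le_trans (enorm_le_norm _)).
apply: (@le_trans _ _ ((n%:R + 1) * (e / (n%:R + 1)))).
  by apply: ler_pM => //; rewrite lerDl.
by rewrite mulrC divfK// gt_eqF.
Qed.

Lemma continuous_speed c : Ck_curve 1 c -> continuous (fun t => enorm (derive1 c t)).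
Proof.
move=> /Ck1_curveP[_ cc] t.
by apply: (@continuous_comp _ _ _ (derive1 c) (@enorm R n)); [exact: cc|exact: continuous_enorm].
Qed.

End Curves.

(** * Length of curves *)

Section CurveLength.
Variables (R : realType) (n : nat).
Implicit Types (u v : 'rV[R]_n) (c : R -> 'rV[R]_n) (t a b : R).
Notation mu := (@lebesgue_measure R).

Lemma curve_length_cst c a : (forall t, 0 <= t <= 1 -> enorm (derive1 c t) = a) ->
  curve_length c = a%:E.
Proof.
move=> ca; rewrite /curve_length (eq_integral (cst a%:E)); last first.
  by move=> t; rewrite inE/= in_itv/= => /ca ->.
by rewrite integral_cst//= lebesgue_measure_itv/= lte_fin ltr01 oppr0 adde0 mule1.
Qed.

Lemma C1_piecewise c : Ck_curve 1 c -> piecewise_C1 c.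
Proof.
move=> c1; exists [:: 1]; split; first exact: itv_partition1.
by move=> i _; exists c; split.
Qed.

Lemma curve_length_le c a : Ck_curve 1 c ->
  (forall t, 0 <= t <= 1 -> enorm (derive1 c t) <= a) ->
  (curve_length c <= a%:E)%E.
Proof.
move=> c1 ca; have a0 : 0 <= a.
  by rewrite (le_trans (enorm_ge0 _) (ca 0 _))// lexx ler01.
have -> : (a%:E = \int[mu]_(t in `[0%R, 1%R]) cst a%:E t)%E.
  by rewrite integral_cst//= lebesgue_measure_itv/= lte_fin ltr01 oppr0 adde0 mule1.
apply: ge0_le_integral => //.
- by move=> t _; rewrite lee_fin enorm_ge0.
- apply/measurable_EFinP; apply: measurable_funTS.
  by apply: continuous_measurable_fun; exact: continuous_speed.
Qed.

(** The fundamental theorem of calculus applied to the component of the curve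
along a vector [u] of norm at most one, whose speed is at most that of the curve. *)
Lemma chord_le_length_piece c g u a b : enorm u <= 1 -> a < b -> Ck_curve 1 g ->
    (forall t, a <= t <= b -> c t = g t) ->
  measurable_fun `[a, b] (fun t => enorm (derive1 c t)) /\
  ((dot u (c b - c a))%:E <= \int[mu]_(t in `[a, b]) (enorm (derive1 c t))%:E)%E.
Proof.
move=> u1 ab g1 cg.
have /Ck1_curveP[dg cg1] := g1.
have cg' : {in `]a, b[, derive1 c =1 derive1 g}.
  move=> t; rewrite in_itv/= => /andP[at_ tb]; rewrite !derive1E.
  apply: near_eq_derive; near=> s; apply: cg.
  have : s \in `]a, b[ by near: s; apply: near_in_itvoo; rewrite in_itv/= at_.
  by rewrite in_itv/= => /andP[/ltW-> /ltW->].
have mg : measurable_fun setT (fun t => enorm (derive1 g t)).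
  by apply: continuous_measurable_fun; exact: continuous_speed.
have mc : measurable_fun `]a, b[ (fun t => enorm (derive1 c t)).
  apply: (@eq_measurable_fun _ _ _ _ _ (fun t => enorm (derive1 g t))).
    by move=> t; rewrite inE/= => tab; rewrite cg'.
  exact: measurable_funTS.
split; first exact: measurable_fun_itv_cc mc.
have -> : (\int[mu]_(t in `[a, b]) (enorm (derive1 c t))%:E =
           \int[mu]_(t in `[a, b]) (enorm (derive1 g t))%:E)%E.
  apply: eq_integral_itv_bounded mc (measurable_funTS mg) _ => t tab.
  by rewrite cg'.
have duc : continuous (fun t => dot u (derive1 g t)).
  move=> t; apply: (@continuous_comp _ _ _ (derive1 g) (dot u)); first exact: cg1.
  exact: continuous_dot.
have dug t : is_derive t 1 (fun s => dot u (g s)) (dot u (derive1 g t)).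
  exact: is_derive_dot.
have cug : continuous (fun t => dot u (g t)).
  by move=> t; apply: differentiable_continuous; apply/derivable1_diffP.
rewrite !cg ?lexx ?(ltW ab)// dotBr EFinB.
rewrite -(@continuous_FTC2 _ (fun t => dot u (derive1 g t)) (fun t => dot u (g t)))//; last 3 first.
- exact: continuous_subspaceT.
- split=> [t _| |]; first by case: (dug t).
    by apply: cvg_at_right_filter; exact: cug.
  by apply: cvg_at_left_filter; exact: cug.
- by move=> t _; rewrite derive1E; exact: derive_val.
apply: le_integral => //.
- apply: continuous_compact_integrable; first exact: segment_compact.
  exact: continuous_subspaceT.
- apply: continuous_compact_integrable; first exact: segment_compact.
  by apply: continuous_subspaceT; exact: continuous_speed.
- move=> t _; rewrite lee_fin (le_trans (cauchy_schwarz _ _))//.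
  by rewrite ler_piMl// enorm_ge0.
Unshelve. all: by end_near. Qed.

(** Measurability of the speed is part of the induction because it is what makes the
integral additive over the pieces; [derive1 c] is arbitrary at the break points. *)
Lemma chord_le_length c u s a b : enorm u <= 1 -> itv_partition a b s ->
    (forall i, (i < size s)%N -> exists g, Ck_curve 1 g /\
      forall t, nth 0 (a :: s) i <= t <= nth 0 s i -> c t = g t) ->
  measurable_fun `[a, b] (fun t => enorm (derive1 c t)) /\
  ((dot u (c b - c a))%:E <= \int[mu]_(t in `[a, b]) (enorm (derive1 c t))%:E)%E.
Proof.
move=> u1; elim: s a => [|x s ih] a.
  move=> /itv_partition_nil <- _; rewrite set_itv1; split.
    exact: measurable_fun_set1.
  by rewrite subrr dotC dot0l integral_set1.
move=> axs cg; have xs := itv_partition_cons axs.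
have ax : a < x by case: axs => /= /andP[].
have xb := itv_partition_le xs.
have [g [g1 cg0]] := cg 0%N isT.
have [m1 i1] := chord_le_length_piece u1 ax g1 cg0.
have [i si|m2 i2] := ih x xs; first exact: (cg i.+1).
have m2' : measurable_fun `]x, b] (fun t => enorm (derive1 c t)).
  by apply: measurable_funS m2 => //; exact: subset_itv_oc_cc.
have E : `[a, b]%classic = `[a, x]%classic `|` `]x, b]%classic.
  by rewrite -itv_bndbnd_setU ?bnd_simp// ltW.
rewrite E; split; first exact/measurable_funU.
rewrite integral_setU//=; last 2 first.
- by apply/measurable_EFinP/measurable_funU.
- apply/disj_setPS => y [/=]; rewrite 2!in_itv/= => /andP[_ yx] /andP[].
  by rewrite ltNge yx.
rewrite (@integral_itv_obnd_cbnd _ x); last exact/measurable_EFinP.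
apply: (le_trans _ (leeD i1 i2)).
by rewrite -EFinD lee_fin -dotDr [X in _ <= dot _ X]addrC subrKA.
Qed.

(** The sharp direction is that of the chord itself. *)
Lemma enorm_le_curve_length c : piecewise_C1 c ->
  ((enorm (c 1 - c 0)%R)%:E <= curve_length c)%E.
Proof.
move=> [s [ps cs]]; set w := c 1 - c 0.
have [w0|w0] := eqVneq (enorm w) 0.
  by rewrite w0; apply: integral_ge0 => t _; rewrite lee_fin enorm_ge0.
have wp : 0 < enorm w by rewrite lt_neqAle eq_sym w0 enorm_ge0.
have [|_] := @chord_le_length c ((enorm w)^-1 *: w) _ _ _ _ ps cs.
  by rewrite enormZ ger0_norm ?invr_ge0 ?enorm_ge0// mulVf.
by rewrite dotZl -sqr_enorm expr2 mulKf.
Qed.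

End CurveLength.

(** * Geodesics of a subset *)

Section Geodesics.
Variables (R : realType) (n : nat).
Implicit Types (M : set 'rV[R]_n) (x y u v : 'rV[R]_n) (c : R -> 'rV[R]_n).
Implicit Types (t a b K : R).

Lemma enorm_le_rdist M x y : ((enorm (y - x)%R)%:E <= rdist M x y)%E.
Proof.
apply: le_ereal_inf_tmp => _ [c [pc _ <- <-] <-].
exact: enorm_le_curve_length.
Qed.

Lemma rdist_le_length M c : piecewise_C1 c -> (forall t, 0 <= t <= 1 -> M (c t)) ->
  (rdist M (c 0%R) (c 1%R) <= curve_length c)%E.
Proof. by move=> pc Mc; apply: ereal_inf_lbound; exists c. Qed.

(** At an interior parameter a reparametrized translate of the curve is a witness of
tangency; at the end points the curve may leave [M]. *)
Lemma tangent_interior M c t : Ck_curve 1 c -> (forall t, 0 <= t <= 1 -> M (c t)) ->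
  0 < t < 1 -> tangent M (c t) (derive1 c t).
Proof.
move=> /Ck1_curveP[dc cc] Mc t01.
have d (s : R) : is_derive s 1 (fun r => c (r + t)) (derive1 c (s + t)).
  have E : (fun h : R => h^-1 *: (c (h *: 1 + s + t) - c (s + t))) =
           (fun h : R => h^-1 *: (c (h *: 1 + (s + t)) - c (s + t))).
    by apply/funext => h; rewrite addrA.
  have := dc (s + t); rewrite derive1E /derivable /derive /= -E => H.
  exact: DeriveDef.
have E : derive1 (fun r => c (r + t)) = (fun s => derive1 c (s + t)).
  by apply/funext => s; rewrite derive1E derive_val.
exists (fun s => c (s + t)); split; last by rewrite E add0r.
- apply/Ck1_curveP; split=> [s|]; first by case: (d s).
  rewrite E => s; apply: (@continuous_comp _ _ _ (+%R^~ t) (derive1 c)).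
    by apply: cvgD; [exact: cvg_id|exact: cvg_cst].
  exact: cc.
- have := @near_in_itvoo _ 0 1 t; rewrite in_itv/= => /(_ t01).
  rewrite (near_shift 0) subr0; apply: filterS => s /=.
  by rewrite in_itv/= => /andP[/ltW ? /ltW ?]; apply: Mc; apply/andP.
- by rewrite add0r.
Qed.

Section OneGeodesic.
Variables (M : set 'rV[R]_n) (c : R -> 'rV[R]_n).
Hypothesis gc : geodesic M c.

Lemma geodesic_C2 : Ck_curve 1 c /\ Ck_curve 1 (derive1 c).
Proof. by case: gc => /Ck2_curve. Qed.

Let dc t : derivable c t 1.
Proof. by have [/Ck1_curveP[]] := geodesic_C2. Qed.

Let ddc t : derivable (derive1 c) t 1.
Proof. by have [_ /Ck1_curveP[]] := geodesic_C2. Qed.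

(** The acceleration is normal and the velocity tangent, so [|c'|^2] has zero
derivative. *)
Lemma geodesic_speed t : 0 <= t <= 1 -> enorm (derive1 c t) = enorm (derive1 c 0).
Proof.
move=> /andP[]; rewrite le_eqVlt => /predU1P[<-//|t0 t1].
rewrite /enorm; congr Num.sqrt; apply/eqP; rewrite -subr_eq0; apply/eqP.
have [s st ->] : exists2 s : R, s \in `]0, t[ &
   dot (derive1 c t) (derive1 c t) - dot (derive1 c 0) (derive1 c 0) =
   2 * dot (derive1 c s) (derive1 (derive1 c) s) * (t - 0).
  apply: (@MVT _ (fun s => dot (derive1 c s) (derive1 c s))
             (fun s => 2 * dot (derive1 c s) (derive1 (derive1 c) s))) => //.
    by move=> s _; exact: is_derive_sqspeed.
  apply: derivable_within_continuous => s _.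
  by have [] := is_derive_sqspeed (@ddc s).
have [c2 Mc nc] := gc; move: st; rewrite in_itv/= => /andP[s0 st].
have s1 := lt_le_trans st t1.
rewrite dotC nc ?mulr0 ?mul0r ?(ltW s0) ?(ltW s1)//.
by apply: tangent_interior; rewrite ?s0//; case: geodesic_C2.
Qed.

Lemma geodesic_length : curve_length c = (enorm (derive1 c 0))%:E.
Proof. by apply: curve_length_cst => t; exact: geodesic_speed. Qed.

Lemma geodesic_chord a b : 0 <= a -> a <= b -> b <= 1 ->
  enorm (c b - c a) <= (b - a) * enorm (derive1 c 0).
Proof.
move=> a0; rewrite le_eqVlt => /predU1P[<- _|ab b1].
  by rewrite !subrr enorm0 mul0r.
apply: enorm_le_dot; first by rewrite mulr_ge0 ?enorm_ge0// subr_ge0 ltW.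
have [s /andP[s0 st] ->] := @dot_mvt _ _ (c b - c a) c _ _ dc ab.
rewrite (mulrC (b - a)) mulrA ler_pM2r ?subr_gt0// -(@geodesic_speed s).
  exact: cauchy_schwarz.
by rewrite (le_trans a0 (ltW s0)) (le_trans (ltW st)).
Qed.

Lemma geodesic_chord_sym a b : 0 <= a <= 1 -> 0 <= b <= 1 ->
  enorm (c b - c a) <= `|b - a| * enorm (derive1 c 0).
Proof.
move=> /andP[a0 a1] /andP[b0 b1]; have [ab|ba] := leP a b.
  by rewrite ger0_norm ?subr_ge0//; exact: geodesic_chord.
rewrite -enormN opprB distrC ger0_norm ?subr_ge0 ?(ltW ba)//.
by apply: geodesic_chord => //; exact: ltW.
Qed.

(** Taylor's formula with the mean value theorem applied twice along the fixed
direction [v], first to [c] and then to [c'], so that no vector-valued integral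
occurs. *)
Lemma geodesic_taylor K v t :
    (forall s, 0 < s < 1 -> enorm (derive1 (derive1 c) s) <= K) -> 0 <= t <= 1 ->
  dot v (c t - c 0 - t *: derive1 c 0) <= enorm v * K * t.
Proof.
move=> cK /andP[]; rewrite le_eqVlt => /predU1P[<- _|t0 t1].
  by rewrite subrr scale0r subrr dotC dot0l mulr0.
have K0 : 0 <= K.
  apply: (le_trans (enorm_ge0 (derive1 (derive1 c) (2^-1)))); apply: cK; lra.
have [s /andP[s0 st] e] := @dot_mvt _ _ v c _ _ dc t0.
rewrite dotBr e subr0 dotZr mulrC -mulrBr mulrC ler_pM2r// -dotBr.
have [r /andP[r0 rs] ->] := @dot_mvt _ _ v (derive1 c) _ _ ddc s0.
rewrite subr0; have s1 : s < 1 := lt_le_trans st t1.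
apply: (@le_trans _ _ (enorm v * K * s)).
  rewrite ler_pM2r//; apply: (le_trans (cauchy_schwarz _ _)).
  by rewrite ler_wpM2l ?enorm_ge0// cK// r0 (lt_trans rs).
by rewrite ler_piMr ?mulr_ge0 ?enorm_ge0// ltW.
Qed.

End OneGeodesic.

Lemma min_geodesic_rdist M x y c : min_geodesic M x y c ->
  rdist M x y = (enorm (derive1 c 0))%:E.
Proof. by case=> /geodesic_length gl _ _ <-. Qed.

Lemma inv_expP M U x y : convex M U -> U x -> U y ->
  exists2 c, min_geodesic M x y c & derive1 c 0 = inv_exp M x y.
Proof.
move=> [_ cU] Ux Uy; have [c [mc _ _]] := cU _ _ Ux Uy.
rewrite /inv_exp; case: xgetP => [_ -> [c' []]|]; first by exists c'.
by move=> /(_ (derive1 c 0))[]; exists c.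
Qed.

End Geodesics.

(** * The whole space as a Riemannian manifold *)

Lemma convex_lt (R : realFieldType) (t a b e : R) :
  0 <= t -> t <= 1 -> a < e -> b < e -> (1 - t) * a + t * b < e.
Proof.
move=> t0 t1 ae be; have [->|tn0] := eqVneq t 0; first by rewrite mul0r addr0 subr0 mul1r.
have tp : 0 < t by rewrite lt_neqAle eq_sym tn0.
apply: (@le_lt_trans _ _ ((1 - t) * e + t * b)).
  by rewrite lerD2r ler_wpM2l ?subr_ge0// ltW.
by rewrite [ltRHS](_ : _ = (1 - t) * e + t * e) ?ltrD2l ?ltr_pM2l//; ring.
Qed.

Section EuclideanSpace.
Variables (R : realType) (n : nat).
Implicit Types (x y u v : 'rV[R]_n) (c : R -> 'rV[R]_n) (t : R).

Definition line x v : R -> 'rV[R]_n := fun t => x + t *: v.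

Lemma line0 x v : line x v 0 = x.
Proof. by rewrite /line scale0r addr0. Qed.

Lemma line1 x y : line x (y - x) 1 = y.
Proof. by rewrite /line scale1r addrC subrK. Qed.

Lemma is_derive_line x v (t w : R) : is_derive (t : R^o) (w : R^o) (line x v) (w *: v).
Proof.
rewrite /line -[w *: v]add0r.
have d : is_derive (t : R^o) (w : R^o) (fun s : R^o => s *: v) (w *: v).
  have d : is_diff (t : R^o) (fun s : R^o => s *: v) (fun s : R^o => s *: v).
    exact: is_diff_scalel.
  apply: DeriveDef; first by apply: diff_derivable.
  by rewrite deriveE// diff_val.
exact: (is_deriveD (is_derive_cst x _ _) d).
Qed.

Lemma derive1_line x v : derive1 (line x v) = cst v.
Proof.
apply/funext => t; rewrite derive1E.
by have [_] := is_derive_line x v t 1; rewrite scale1r.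
Qed.

Lemma Ck2_line x v : Ck_curve 2 (line x v).
Proof.
split=> [t _|w]; first by apply/derivable1_diffP; case: (is_derive_line x v t 1).
have -> : (fun t : R^o => 'D_w (line x v) t) = cst (w *: v).
  by apply/funext => t; case: (is_derive_line x v t w).
split=> [t _|w' t _]; first exact: differentiable_cst.
have -> : (fun t : R^o => 'D_w' (cst (w *: v)) t) = cst 0.
  by apply/funext => s; rewrite derive_cst.
exact: cst_continuous.
Qed.

Lemma tangent_setT x v : tangent setT x v.
Proof.
exists (line x v); split.
- by case: (Ck2_curve (Ck2_line x v)).
- by apply: filterE.
- by rewrite line0.
- by rewrite derive1_line.
Qed.

(** The segment has length [|y - x|], and no curve is shorter than its chord. *)
Lemma rdist_setT x y : rdist setT x y = (enorm (y - x))%:E.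
Proof.
apply/eqP; rewrite eq_le enorm_le_rdist andbT.
have := @rdist_le_length _ _ setT (line x (y - x)).
rewrite line0 line1.
rewrite (@curve_length_cst _ _ _ (enorm (y - x))); last by rewrite derive1_line.
apply=> //; apply: C1_piecewise.
by case: (Ck2_curve (Ck2_line x (y - x))).
Qed.

Lemma min_geodesic_line x y : min_geodesic setT x y (line x (y - x)).
Proof.
split.
- split=> // [|t _ v _]; first exact: Ck2_line.
  by rewrite derive1_line derive1_cst dot0l.
- by rewrite line0.
- by rewrite line1.
- rewrite rdist_setT; apply: curve_length_cst => t _.
  by rewrite derive1_line.
Qed.

(** All vectors are tangent to the whole space, so a geodesic has zero acceleration
and its Taylor remainder vanishes. *)
Lemma geodesic_setT c t : geodesic setT c -> 0 <= t <= 1 ->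
  c t = line (c 0) (derive1 c 0) t.
Proof.
move=> gc t01; apply/eqP; rewrite -subr_eq0; apply/eqP/dot_eq0.
apply/eqP; rewrite eq_le dot_ge0 andbT /line opprD addrA.
set u := _ - _ - _.
have -> : 0 = enorm u * 0 * t by rewrite mulr0 mul0r.
apply: (geodesic_taylor gc) => // s /andP[/ltW s0 /ltW s1].
case: gc => _ _ nc; rewrite /enorm nc ?sqrtr0 ?s0//.
exact: tangent_setT.
Qed.

Lemma min_geodesic_setT x y c : min_geodesic setT x y c ->
  derive1 c 0 = y - x /\ forall t, 0 <= t <= 1 -> c t = line x (y - x) t.
Proof.
move=> [gc c0 c1 _].
have c0' : derive1 c 0 = y - x.
  have := @geodesic_setT c 1 gc; rewrite ler01 lexx => /(_ isT).
  by rewrite c1 /line scale1r c0 => ->; rewrite addrC addKr.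
by split=> // t t01; rewrite (geodesic_setT gc)// c0 c0'.
Qed.

Lemma inv_exp_setT x y : inv_exp setT x y = y - x.
Proof.
rewrite /inv_exp; case: xgetP => [_ -> [c [mc <-]]|].
  by case: (min_geodesic_setT mc).
move=> /(_ (y - x))[]; exists (line x (y - x)).
by split; [exact: min_geodesic_line|rewrite derive1_line].
Qed.

Lemma rball_setT x e y : rball setT x e y <-> enorm (y - x) < e.
Proof. by rewrite /rball/= rdist_setT lte_fin; split=> [[]|]. Qed.

Lemma convex_rball_setT x e : convex setT (rball setT x e).
Proof.
split=> // y z /rball_setT ye /rball_setT ze.
exists (line y (z - y)); split; first exact: min_geodesic_line.
  by move=> c /min_geodesic_setT[].
move=> t /andP[t0 t1]; apply/rball_setT; rewrite /line.
have -> : y + t *: (z - y) - x = (1 - t) *: (y - x) + t *: (z - x).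
  by rewrite !scalerBr !scalerBl scale1r; apply/rowP => i; rewrite !mxE; ring.
apply: (le_lt_trans (enormD _ _)); rewrite !enormZ (ger0_norm t0) ger0_norm ?subr_ge0//.
by rewrite convex_lt.
Qed.

End EuclideanSpace.

(** * Orthogonal projection on a row space *)

Section OrthogonalProjection.
Variables (R : realType) (n : nat).
Implicit Types (A : 'M[R]_n) (u v b : 'rV[R]_n).

Lemma dot_mulmx u v : dot u v = (u *m v^T) 0 0.
Proof. by rewrite mxE; apply: eq_bigr => i _; rewrite mxE. Qed.

(** The normal equations [a A A^T = v A^T] are solvable because [A] and
[A A^T] have the same left kernel: [u A A^T = 0] gives [|u A|^2 = 0]. *)
Lemma orthogonal_projection A v :
  exists a, forall b, dot (v - a *m A) (b *m A) = 0.
Proof.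
have kerS : (kermx (A *m A^T) <= kermx A)%MS.
  apply/rV_subP => u /sub_kermxP uAA; apply/sub_kermxP; apply: dot_eq0.
  by rewrite dot_mulmx trmx_mul mulmxA -(mulmxA u) uAA mul0mx mxE.
have AA : (A^T <= A *m A^T)%MS.
  have [le_rk <-] := mxrank_leqif_sup (submxMl A A^T).
  rewrite eqn_leq le_rk mxrank_tr; have := mxrankS kerS.
  by rewrite !mxrank_ker leq_sub2lE// rank_leq_row.
have /submxP[a aE] : (v *m A^T <= A *m A^T)%MS.
  exact: submx_trans (submxMl v _) AA.
exists a => b; rewrite dot_mulmx trmx_mul mulmxA mulmxBl -mulmxA -aE.
by rewrite subrr mul0mx mxE.
Qed.

End OrthogonalProjection.

(** * Local bounds for continuously differentiable maps *)

Section LocalBounds.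
Variables (R : realType) (m n : nat).
Implicit Types (h : 'rV[R]_m -> 'rV[R]_n) (A W : set 'rV[R]_m).

Lemma coord_le_norm (p : nat) (u : 'rV[R]_p) i : `|u 0 i| <= `|u|.
Proof.
rewrite [leRHS]/Num.Def.normr/= mx_normrE.
exact: (le_bigmax _ (fun ij => `|u ij.1 ij.2|) (0, i)).
Qed.

Lemma norm_le_coord (p : nat) (u : 'rV[R]_p) (a : R) : 0 <= a ->
  (forall i, `|u 0 i| <= a) -> `|u| <= a.
Proof.
move=> a0 ua; rewrite [leLHS]/Num.Def.normr/= mx_normrE bigmax_le// => -[i j] _.
by rewrite ord1.
Qed.

Lemma derive_sum_coord h p v : differentiable h p ->
  'D_v h p = \sum_(j < m) v 0 j *: 'D_(delta_mx 0 j) h p.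
Proof.
move=> dh; rewrite deriveE// [in LHS](row_sum_delta v) linear_sum.
by apply: eq_bigr => j _; rewrite linearZ deriveE.
Qed.

Lemma norm_sum_coord (F : 'I_m -> 'rV[R]_n) (B : 'I_m -> R) (v : 'rV[R]_m) :
  (forall j, `|F j| <= B j) ->
  `|\sum_(j < m) v 0 j *: F j| <= (\sum_(j < m) B j) * `|v|.
Proof.
move=> FB; apply: (le_trans (ler_norm_sum _ _ _)); rewrite mulr_suml.
apply: ler_sum => j _; rewrite normrZ mulrC ler_pM//; exact: coord_le_norm.
Qed.

(** The differential at [q] is controlled by the finitely many partial derivatives,
each of which is bounded near [p] by continuity. *)
Lemma Ck1_local_bound h A p : open A -> A p -> Ck 1 A h ->
  exists L W, [/\ 0 <= L, nbhs p W, W `<=` A &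
    forall q v, W q -> `|'D_v h q| <= L * `|v|].
Proof.
move=> oA Ap [dh ch]; pose B j := `|'D_(delta_mx 0 j) h p| + 1.
exists (\sum_(j < m) B j).
exists (A `&` [set q | forall j : 'I_m, `|'D_(delta_mx 0 j) h q| <= B j]); split.
- by apply: sumr_ge0 => j _; rewrite addr_ge0.
- apply: filterI; first exact: open_nbhs_nbhs.
  apply: (filter_forall (nbhs_filter p)) => j.
  have cj := ch (delta_mx 0 j) p Ap.
  have /cvgrPdist_le/(_ 1 ltr01) := cj; apply: filterS => q.
  rewrite distrC => hq; rewrite /B -lerBlDl.
  exact: le_trans (lerB_dist _ _) hq.
- exact: subIsetl.
- move=> q v [Aq Bq]; rewrite derive_sum_coord; last exact: dh.
  exact: norm_sum_coord.
Qed.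

(** The mean value theorem for each coordinate along the segment, which stays in a
ball on which the differential is bounded. *)
Lemma Ck1_local_lipschitz h A p : open A -> A p -> Ck 1 A h ->
  exists L W, [/\ 0 <= L, nbhs p W &
    forall q1 q2, W q1 -> W q2 -> `|h q1 - h q2| <= L * `|q1 - q2|].
Proof.
move=> oA Ap hC; have [L [W [L0 pW WA LW]]] := Ck1_local_bound oA Ap hC.
have /nbhs_ballP[r /= r0 rW] := pW.
exists L, (ball p r); split=> //; first exact: nbhsx_ballx.
move=> q1 q2 pq1 pq2; apply: norm_le_coord => [|i]; first by rewrite mulr_ge0.
pose l := line q2 (q1 - q2).
have lW (t : R) : 0 <= t <= 1 -> W (l t).
  move=> /andP[t0 t1]; apply: rW; move: pq1 pq2; rewrite -!ball_normE /= => pq1 pq2.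
  have -> : p - l t = (1 - t) *: (p - q2) + t *: (p - q1).
    rewrite /l /line !scalerBr !scalerBl !scale1r.
    by apply/rowP => j; rewrite !mxE; ring.
  apply: (le_lt_trans (ler_normD _ _)).
  by rewrite !normrZ (ger0_norm t0) ger0_norm ?subr_ge0// convex_lt.
have dl t : derivable l t 1.
  by have [/Ck1_curveP[]] := Ck2_curve (Ck2_line q2 (q1 - q2)).
have dhl (t : R) : 0 <= t <= 1 -> is_derive t 1 (fun s => h (l s) 0 i)
    ('D_(q1 - q2) h (l t) 0 i).
  move=> t01; have dh : differentiable h (l t).
    by case: hC => + _; apply; apply: WA; exact: lW.
  have D := is_derive_chain (dl t) dh.
  have := @is_derive_coord _ _ (h \o l) t i; rewrite derive1E.
  have [dhl ->] := D; rewrite derive1_line -deriveE//; exact.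
have [t t01 e] : exists2 t : R, t \in `]0, 1[ &
   h (l 1) 0 i - h (l 0) 0 i = 'D_(q1 - q2) h (l t) 0 i * (1 - 0).
  apply: (@MVT _ (fun s => h (l s) 0 i) (fun s => 'D_(q1 - q2) h (l s) 0 i)) => //.
    by move=> t; rewrite in_itv/= => /andP[/ltW t0 /ltW t1]; apply: dhl; rewrite t0.
  apply: derivable_within_continuous => t; rewrite in_itv/= => /dhl.
  by case.
move: e; rewrite /l line1 line0 subr0 mulr1 !mxE => ->.
apply: (le_trans (coord_le_norm _ _)); apply: LW; apply: lW.
by move: t01; rewrite in_itv/= => /andP[/ltW -> /ltW ->].
Qed.

(** The partial derivatives of a [C^2] map are [C^1], hence locally Lipschitz. *)
Lemma Ck2_diff_lipschitz h A p : open A -> A p -> Ck 2 A h ->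
  exists L W, [/\ 0 <= L, nbhs p W &
    forall q1 q2 v, W q1 -> W q2 ->
      `|'D_v h q1 - 'D_v h q2| <= L * `|q1 - q2| * `|v|].
Proof.
move=> oA Ap [dh ch].
have /choice[LW LWP] j : exists LW : R * set 'rV[R]_m, [/\ 0 <= LW.1, nbhs p LW.2 &
    forall q1 q2, LW.2 q1 -> LW.2 q2 ->
      `|'D_(delta_mx 0 j) h q1 - 'D_(delta_mx 0 j) h q2| <= LW.1 * `|q1 - q2|].
  have [L [W LWP]] := Ck1_local_lipschitz oA Ap (ch (delta_mx 0 j)).
  by exists (L, W).
exists (\sum_(j < m) (LW j).1), (A `&` [set q | forall j, (LW j).2 q]); split.
- by apply: sumr_ge0 => j _; case: (LWP j).
- apply: filterI; first exact: open_nbhs_nbhs.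
  by apply: (filter_forall (nbhs_filter p)) => j; case: (LWP j).
- move=> q1 q2 v [Aq1 W1] [Aq2 W2].
  rewrite !derive_sum_coord; [|exact: dh..].
  rewrite -sumrB mulr_suml; under eq_bigr do rewrite -scalerBr.
  by apply: norm_sum_coord => j; case: (LWP j) => _ _; apply.
Qed.

End LocalBounds.

(** * One-sided difference quotients and sine curves *)

Section OneSided.
Variable R : realType.

(** Also at the end points of [0, 1] the difference quotients taken from inside the
interval converge to the derivative; a geodesic lies in [M] on [0, 1] only. *)
Lemma derive_le_in_itv (phi : R -> R) (d t B : R) : is_derive t 1 phi d ->
    0 <= t <= 1 ->
    (\forall s \near t, 0 <= s <= 1 -> `|phi s - phi t| <= B * `|s - t|) ->
  `|d| <= B.
Proof.
move=> [dphi <-] /andP[t0 t1] phiB; apply/ler_addgt0Pr => e e0.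
move: phiB; rewrite (near_shift 0) subr0 => /nbhs_ballP[r1 /= r10 phiB].
have /cvgrPdist_le/(_ e e0) := dphi.
move=> /nbhs_ballP[r2 /= r20 phie].
pose r := Order.min (2^-1) (Order.min r1 r2 / 2).
have r0 : 0 < r by rewrite lt_min invr_gt0 ltr0n divr_gt0 ?lt_min ?r10 ?r20 ?ltr0n.
have [rr1 rr2] : r < r1 /\ r < r2.
  have h12 : Order.min r1 r2 / 2 < Order.min r1 r2.
    by rewrite gtr_pMr ?invf_lt1 ?ltr1n// lt_min r10 r20.
  split; rewrite gt_min; apply/orP; right; apply: (lt_le_trans h12).
    by rewrite ge_min lexx.
  by rewrite ge_min lexx orbT.
have r12 : r <= 2^-1 by rewrite ge_min lexx.
have [h [hr ht]] : exists h, `|h| = r /\ 0 <= h + t <= 1.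
  have [t2|t2] := leP t (2^-1).
    by exists r; split; [rewrite gtr0_norm|apply/andP; split; lra].
  by exists (- r); split; [rewrite normrN gtr0_norm|apply/andP; split; lra].
have hn0 : h != 0 by rewrite -normr_gt0 hr.
have b1 : `|phi (h + t) - phi t| <= B * `|h|.
  have := phiB h; rewrite -ball_normE/= sub0r normrN hr => /(_ rr1 ht).
  by rewrite addrK hr.
have b2 : `|'D_1 phi t - h^-1 * (phi (h + t) - phi t)| <= e.
  have := phie h; rewrite -ball_normE/= sub0r normrN hr => /(_ rr2 hn0).
  by rewrite [h *: 1]mulr1.
rewrite -(subrK (h^-1 * (phi (h + t) - phi t)) ('D_1 phi t)) addrC.
apply: (le_trans (ler_normD _ _)); apply: lerD => //.
by rewrite normrM normfV ler_pdivrMl ?normr_gt0// mulrC.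
Qed.

End OneSided.

Section SineCurve.
Variables (R : realType) (m n : nat).

(** Curves have to be [C^1] on the whole line while the map [g] is controlled only
near [z].  Running through the segment from [z - b] to [z + b] with a sine keeps the
curve in the domain for all times. *)
Lemma sine_curve (g : 'rV[R]_m -> 'rV[R]_n) (V : set 'rV[R]_m) z b (lam : R) :
    Ck 1 V g -> (forall s : R, `|s| <= 1 -> V (line z b s)) ->
  let gam := fun t => g (line z b (sin (lam * t))) in
  Ck_curve 1 gam /\
  forall t, derive1 gam t =
    (lam * cos (lam * t)) *: 'D_b g (line z b (sin (lam * t))).
Proof.
move=> [dg cg] Vl gam; pose sig (t : R) : R := sin (lam * t).
have s1 (t : R) : `|sig t| <= 1 by rewrite ler_norml sin_geN1 sin_le1.
have dsig (t : R) : is_derive t 1 sig (lam * cos (lam * t)).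
  have dlam : is_derive t 1 ( *%R lam) lam.
    by have := is_deriveZ lam (is_derive_id t (1 : R)); rewrite [_ *: _]mulr1.
  by have := is_derive1_comp (is_derive_sin (lam * t)) dlam; rewrite mulrC.
have dlsig (t : R) : is_derive t 1 (line z b \o sig) ((lam * cos (lam * t)) *: b).
  have dl : differentiable (line z b : R^o -> _) (sig t).
    by apply/derivable1_diffP; case: (is_derive_line z b (sig t) 1).
  have [ds dsE] := dsig t.
  have := is_derive_chain ds dl; rewrite derive1E dsE -deriveE//.
  by have [_ ->] := is_derive_line z b (sig t) (lam * cos (lam * t)).
have dgam (t : R) : is_derive t 1 gam
    ((lam * cos (lam * t)) *: 'D_b g (line z b (sin (lam * t)))).
  have dgt : differentiable g ((line z b \o sig) t) by apply: dg; exact/Vl.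
  have [dl dlE] := dlsig t.
  have := is_derive_chain dl dgt.
  by rewrite derive1E dlE linearZ deriveE.
have gam' : derive1 gam = fun t =>
    (lam * cos (lam * t)) *: 'D_b g (line z b (sin (lam * t))).
  by apply/funext => t; rewrite derive1E; have [_ ->] := dgam t.
split=> [|t]; last by rewrite gam'.
apply/Ck1_curveP; split=> [t|]; first by case: (dgam t).
rewrite gam' => t; apply: cvgZ.
  apply: cvgMr; apply: (@continuous_comp _ _ _ ( *%R lam) cos).
    exact: mulrl_continuous.
  exact: continuous_cos.
apply: (@continuous_comp _ _ _ (line z b \o sig) ('D_b g)).
  by apply: differentiable_continuous; apply/derivable1_diffP; case: (dlsig t).
by apply: cg; exact: Vl.
Qed.

End SineCurve.

(** * Slice charts *)

Section Chart.
Variables (R : realType) (n k : nat) (M U V : set 'rV[R]_n).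
Variables (f g : 'rV[R]_n -> 'rV[R]_n).
Hypotheses (oU : open U) (oV : open V) (fC : Ck 2 U f) (gC : Ck 2 V g).
Hypothesis fK : forall x, U x -> V (f x) /\ g (f x) = x.
Hypothesis gK : forall z, V z -> U (g z) /\ f (g z) = z.

(** The slice [R^k x {0}]. *)
Definition flat (a : 'rV[R]_n) := forall i : 'I_n, (k <= i)%N -> a 0 i = 0.

Hypothesis fM : forall x, U x -> (M x <-> flat (f x)).

Implicit Types (p q a b v : 'rV[R]_n) (c : R -> 'rV[R]_n).

Lemma flatD a b : flat a -> flat b -> flat (a + b).
Proof. by move=> fa fb i ki; rewrite mxE fa// fb// addr0. Qed.

Lemma flatZ (r : R) a : flat a -> flat (r *: a).
Proof. by move=> fa i ki; rewrite mxE fa// mulr0. Qed.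

Lemma flatB a b : flat a -> flat b -> flat (a - b).
Proof. by move=> fa fb; rewrite -scaleN1r; apply: flatD => //; exact: flatZ. Qed.

Lemma pid_flat b : flat (b *m pid_mx k).
Proof.
move=> i ki; rewrite mxE big1// => j _; rewrite mxE.
by case: eqP => [/= ->|]; rewrite ?mulr0// ltnNge ki mulr0.
Qed.

Lemma flat_pid b : flat b -> b *m pid_mx k = b.
Proof.
move=> fb; apply/rowP => j; rewrite mxE (bigD1 j)//= mxE eqxx/=.
rewrite big1 ?addr0 => [|i]; last first.
  by rewrite -val_eqE mxE => /negbTE ->; rewrite mulr0.
by have [|kj] := ltnP j k; rewrite ?mulr1// fb// mul0r.
Qed.

Lemma chart_inv_M z : V z -> flat z -> M (g z).
Proof. by move=> /gK[Ugz fgz] fz; apply/(fM Ugz); rewrite fgz. Qed.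

Let df p : U p -> differentiable f p. Proof. by case: fC => + _; apply. Qed.
Let dg z : V z -> differentiable g z. Proof. by case: gC => + _; apply. Qed.
Let gC1 : Ck 1 V g.
Proof.
split; first by case: gC.
move=> v z Vz; apply: differentiable_continuous.
by case: gC => _ /(_ v)[+ _]; apply.
Qed.

(** The image under the inverse chart of an oscillation around [f p] in the direction
[a], of amplitude small enough to stay in the chart, lies in [M] and has the velocity
['D_a g (f p)] at time zero. *)
Lemma chart_tangent p a : M p -> U p -> flat a -> tangent M p ('D_a g (f p)).
Proof.
move=> Mp Up fa; have [Vfp gfp] := fK Up.
have /nbhs_ballP[r /= r0 rV] := open_nbhs_nbhs (conj oV Vfp).
(* The frequency compensates for the amplitude [lam^-1 * `|a| < r]. *)
pose lam := `|a| / r + 1.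
have lam0 : 0 < lam by rewrite ltr_wpDl// divr_ge0 ?normr_ge0 ?(ltW r0).
have lV (s : R) : `|s| <= 1 -> V (line (f p) (lam^-1 *: a) s).
  move=> s1; apply: rV; rewrite -ball_normE /= /line opprD addrA subrr sub0r normrN.
  rewrite !normrZ (@gtr0_norm _ lam^-1) ?invr_gt0//.
  apply: (@le_lt_trans _ _ (1 * (lam^-1 * `|a|))).
    by rewrite ler_wpM2r// mulr_ge0// invr_ge0 ltW.
  rewrite mul1r ltr_pdivrMl// /lam mulrDl divfK ?gt_eqF// mul1r.
  by rewrite ltrDl.
have [cC c'] := sine_curve lam gC1 lV.
exists (fun t => g (line (f p) (lam^-1 *: a) (sin (lam * t)))); split=> //.
- apply: filterE => t; apply: chart_inv_M.
    by apply: lV; rewrite ler_norml sin_geN1 sin_le1.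
  by apply: flatD; [exact/fM|do 2!apply: flatZ].
- by rewrite mulr0 sin0 line0.
- rewrite c' mulr0 sin0 cos0 line0 mulr1 !deriveE; [|exact: dg..].
  by rewrite linearZ scalerA mulfV ?scale1r// gt_eqF.
Qed.

(** The curve is the image under the inverse chart of the segment from [f p] to
[f q], parametrized by [sin (pi t / 2)], whence the factor [pi / 2]. *)
Lemma chart_rdist p q (L : R) : M p -> U p -> M q -> U q ->
    (forall s : R, `|s| <= 1 -> V (line (f p) (f q - f p) s)) ->
    (forall s : R, `|s| <= 1 ->
      enorm ('D_(f q - f p) g (line (f p) (f q - f p) s)) <= L) ->
  (rdist M p q <= (pi / 2 * L)%:E)%E.
Proof.
move=> Mp Up Mq Uq lV lL; set b := f q - f p in lV lL *.
have [cC c'] := sine_curve (pi / 2) gC1 lV.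
set c := fun t => g _ in cC c'.
have c0 : c 0 = p by rewrite /c mulr0 sin0 line0; case: (fK Up).
have c1 : c 1 = q by rewrite /c mulr1 sin_pihalf line1; case: (fK Uq).
have sin1 (t : R) : `|sin t| <= 1 by rewrite ler_norml sin_geN1 sin_le1.
have pi20 : 0 <= pi / 2 :> R by rewrite divr_ge0// pi_ge0.
rewrite -{1}c0 -{1}c1; apply: (@le_trans _ _ (curve_length c)).
  apply: rdist_le_length; first exact: C1_piecewise.
  move=> t _; apply: chart_inv_M; first exact: lV.
  by apply: flatD; [exact/fM|apply/flatZ/flatB; exact/fM].
apply: curve_length_le => // t _; rewrite c' enormZ.
rewrite normrM (ger0_norm pi20) -[leLHS]mulrA; apply: ler_wpM2l => //.
apply: (@le_trans _ _ (1 * L)); last by rewrite mul1r.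
by rewrite ler_pM ?enorm_ge0 ?lL// ler_norml cos_geN1 cos_le1.
Qed.

(** [a] is the velocity of the chart image [f \o c], whose last coordinates vanish on
[0, 1].  Its flatness holds at the end points too, where [tangent_interior] says
nothing. *)
Lemma chart_velocity c (t : R) : Ck_curve 1 c ->
    (forall s, 0 <= s <= 1 -> M (c s)) -> 0 <= t <= 1 -> U (c t) ->
  let a := 'D_(derive1 c t) f (c t) in
  flat a /\ derive1 c t = 'D_a g (f (c t)).
Proof.
move=> /Ck1_curveP[dc _] Mc t01 Ut a; have [Vt gt] := fK Ut; split.
  move=> i ki; have := is_derive_chain (dc t) (df Ut); rewrite -deriveE; last exact: df.
  rewrite -/a => -[dfc dfcE].
  have := @is_derive_coord _ _ (f \o c) t i dfc; rewrite derive1E dfcE => D.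
  apply/eqP; rewrite -normr_le0.
  apply: (derive_le_in_itv D t01).
  have /derivable1_diffP/differentiable_continuous cc := dc t.
  have : \forall s \near t, U (c s) by apply: cc; exact: open_nbhs_nbhs.
  apply: filterS => s Us s01 /=; rewrite mul0r.
  have ->: f (c s) 0 i = 0 by apply: (fM Us).1 => //; exact: Mc.
  have ->: f (c t) 0 i = 0 by apply: (fM Ut).1 => //; exact: Mc.
  by rewrite subrr normr0.
have gf : \forall p \near c t, id p = (g \o f) p.
  have := open_nbhs_nbhs (conj oU Ut); apply: filterS => p Up /=.
  by case: (fK Up).
have := near_eq_derive (derive1 c t) gf.
rewrite derive_id => E; rewrite [LHS]E deriveE; last first.
  by apply: differentiable_comp; [exact: df|exact: dg].
rewrite diff_comp; [|exact: df|exact: dg].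
by rewrite /a /= (deriveE _ (df Ut)) (deriveE _ (dg Vt)).
Qed.

(** A bound on the second fundamental form.  With [a_s] the chart velocity at time
[s], [c'(s) - c'(t)] is the sum of [E], the increment of the differential of [g]
applied to [a_s], and of the image of [a_s - a_t] under the differential at
[f (c t)], which is tangent and so orthogonal to [c''(t)].  Since
[|E| = O(|s - t| |c'|^2)], the derivative [<c''(t), c''(t)>] of [s |-> <c''(t), c'(s)>]
at [t] is [O(|c''(t)| |c'|^2)]. *)
Lemma chart_acceleration (A : set 'rV[R]_n) (F L G : R) c (t : R) :
    0 <= F -> 0 <= L -> 0 <= G -> A `<=` U ->
    (forall p v, A p -> `|'D_v f p| <= F * `|v|) ->
    (forall p q, A p -> A q -> `|f p - f q| <= L * `|p - q|) ->
    (forall p q v, A p -> A q ->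
       `|'D_v g (f p) - 'D_v g (f q)| <= G * `|f p - f q| * `|v|) ->
    geodesic M c -> 0 < t < 1 -> (\forall s \near t, A (c s)) ->
  enorm (derive1 (derive1 c) t) <=
    n%:R * (G * L * F) * enorm (derive1 c 0) ^+ 2.
Proof.
move=> F0 L0 G0 AU dfF fL gG gc /andP[t0 t1] cA.
have [c1 c2] := geodesic_C2 gc; have [_ Mc nc] := gc.
set w := derive1 (derive1 c) t; set e := enorm (derive1 c 0).
have e0 : 0 <= e := enorm_ge0 _.
have t01 : 0 <= t <= 1 by rewrite !ltW.
have At : A (c t) := nbhs_singleton cA.
have [Vt _] := fK (AU _ At).
have dcw : is_derive t 1 (fun s => dot w (derive1 c s)) (dot w w).
  by apply: is_derive_dot; have /Ck1_curveP[] := c2.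
set K := n%:R * _ * _.
have K0 : 0 <= K by rewrite !mulr_ge0// ?exprn_ge0.
apply: enorm_le_dot => //; rewrite -[leLHS]ger0_norm ?dot_ge0//.
apply: (derive_le_in_itv dcw t01); apply: filterS cA => s As s01.
have [fs cs] := chart_velocity c1 Mc s01 (AU _ As).
have [ft ct] := chart_velocity c1 Mc t01 (AU _ At).
set as_ := 'D_(derive1 c s) f (c s) in fs cs.
set at_ := 'D_(derive1 c t) f (c t) in ft ct.
set E := 'D_as_ g (f (c s)) - 'D_as_ g (f (c t)).
have -> : dot w (derive1 c s) - dot w (derive1 c t) = dot w E.
  have -> : E = derive1 c s - derive1 c t - 'D_(as_ - at_) g (f (c t)).
    have -> : 'D_(as_ - at_) g (f (c t)) =
        'D_as_ g (f (c t)) - 'D_at_ g (f (c t)).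
      by rewrite !(deriveE _ (dg Vt)) linearB.
    by rewrite -ct /E -cs opprB addrA subrK.
  have N : dot w ('D_(as_ - at_) g (f (c t))) = 0.
    apply: (nc _ t01); apply: (chart_tangent (Mc _ t01) (AU _ At)).
    exact: flatB.
  by rewrite dotBr N subr0 dotBr.
apply: (le_trans (cauchy_schwarz_norm _ _)); rewrite -mulrA.
rewrite ler_wpM2l ?enorm_ge0//; apply: (le_trans (enorm_le_norm _)).
rewrite /K -!mulrA ler_wpM2l//.
apply: (le_trans (gG _ _ _ As At)); rewrite -!mulrA ler_wpM2l//.
apply: (@le_trans _ _ ((L * (`|s - t| * e)) * (F * e))).
  apply: ler_pM => //.
    apply: (le_trans (fL _ _ As At)); rewrite ler_wpM2l//.
    exact: (le_trans (norm_le_enorm _) (geodesic_chord_sym gc t01 s01)).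
  apply: (le_trans (dfF _ _ As)); rewrite ler_wpM2l//.
  by apply: (le_trans (norm_le_enorm _)); rewrite (geodesic_speed gc s01).
by rewrite le_eqVlt; apply/orP; left; apply/eqP; ring.
Qed.

End Chart.

Section LocalGeometry.
Variables (R : realType) (n : nat).
Implicit Types (M : set 'rV[R]_n) (p q v : 'rV[R]_n) (c : R -> 'rV[R]_n).

(** The only properties of the submanifold that the comparison uses, uniformly near
[x0] and free of charts.  The rows of [J] span the tangent space at [p]; only
tangency of their combinations and the fact that they yield the initial velocities of
geodesics are recorded. *)
Lemma submanifold_local_geometry k M x0 : submanifold k M -> M x0 ->
  exists r K C : R, [/\ 0 < r, 0 <= K /\ 0 < C,
    forall p q, M p -> M q -> enorm (p - x0) < r -> enorm (q - x0) < r ->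
      (rdist M p q <= (C * enorm (q - p))%:E)%E,
    forall c, geodesic M c -> enorm (c 0 - x0) < r -> enorm (derive1 c 0) < r ->
      forall t, 0 < t < 1 ->
        enorm (derive1 (derive1 c) t) <= K * enorm (derive1 c 0) ^+ 2 &
    forall p, M p -> enorm (p - x0) < r -> exists J : 'M[R]_n,
      (forall b, tangent M p (b *m J)) /\
      (forall c, geodesic M c -> c 0 = p -> exists b, derive1 c 0 = b *m J)].
Proof.
move=> [_ sM] Mx0.
have [U [V [f [g [[oU oV Ux0] [fC gC] fK gK fM]]]]] := sM _ Mx0.
have [Vz0 gz0] := fK _ Ux0.
have dg z : V z -> differentiable g z by case: gC => + _; apply.
have f1 : Ck 1 U f.
  split; first by case: fC.
  move=> v z Vz; apply: differentiable_continuous.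
  by case: fC => _ /(_ v)[+ _]; apply.
have g1 : Ck 1 V g.
  split; first by case: gC.
  move=> v z Vz; apply: differentiable_continuous.
  by case: gC => _ /(_ v)[+ _]; apply.
have [F [W1 [F0 nW1 W1U dfF]]] := Ck1_local_bound oU Ux0 f1.
have [L [W2 [L0 nW2 fL]]] := Ck1_local_lipschitz oU Ux0 f1.
have [B [W3 [B0 nW3 W3V dgB]]] := Ck1_local_bound oV Vz0 g1.
have [G [W4 [G0 nW4 gG]]] := Ck2_diff_lipschitz oV Vz0 gC.
have /nbhs_ballP[rho /= rho0 rhoW3] := nW3.
(* The sine curve joining two chart images prolongs their segment backwards by its own
length, hence stays within [rho] of [f x0] if they are within [rho / 3]. *)
have rho3 : 0 < rho / 3 by rewrite divr_gt0.
have cf : {for x0, continuous f}.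
  by apply: differentiable_continuous; case: fC => + _; apply.
pose A := (W1 `&` W2) `&` (f @^-1` (ball (f x0) (rho / 3) `&` W4)).
have nA : nbhs x0 A.
  apply: filterI; first exact: filterI.
  by apply: cf; apply: filterI => //; exact: nbhsx_ballx.
have /nbhs_ballP[r /= r0 rA] := nA.
have AU : A `<=` U by move=> p [[/W1U]].
have {}rA p : enorm (p - x0) < r -> A p.
  move=> pr; apply: rA; rewrite -ball_normE/= distrC.
  exact: le_lt_trans (norm_le_enorm _) pr.
(* Half the radius leaves room for a geodesic of length less than [r / 2]. *)
exists (r / 2), (n%:R * (G * L * F)), (pi / 2 * (n%:R * (B * L)) + 1).
have r20 : 0 < r / 2 by rewrite divr_gt0.
have r2r : r / 2 < r by rewrite gtr_pMr// invf_lt1 ?ltr1n.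
have pi20 : 0 <= pi / 2 :> R by rewrite divr_ge0// pi_ge0.
split=> //.
- split; first by rewrite !mulr_ge0.
  by apply: ltr_wpDl; [apply: mulr_ge0 => //; rewrite !mulr_ge0|exact: ltr01].
- move=> p q Mp Mq /lt_trans/(_ r2r)/rA Ap /lt_trans/(_ r2r)/rA Aq.
  have [[_ W2p] [bp _]] := Ap; have [[_ W2q] [bq _]] := Aq.
  have lW (s : R) : `|s| <= 1 -> W3 (line (f p) (f q - f p) s).
    move=> s1; apply: rhoW3; move: bp bq; rewrite -!ball_normE /= => bp bq.
    rewrite /line opprD addrA; apply: (le_lt_trans (ler_normB _ _)).
    rewrite normrZ.
    have : `|s| * `|f q - f p| <= `|f x0 - f q| + `|f x0 - f p|.
      apply: (@le_trans _ _ (1 * `|f q - f p|)); first by rewrite ler_wpM2r.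
      rewrite mul1r -(subrKA (f x0)) (distrC (f x0) (f q)).
      exact: ler_normD.
    by move: bp bq; lra.
  have lL (s : R) : `|s| <= 1 -> enorm ('D_(f q - f p) g (line (f p) (f q - f p) s))
      <= n%:R * (B * L) * enorm (q - p).
    move=> s1; apply: (le_trans (enorm_le_norm _)); rewrite -!mulrA ler_wpM2l//.
    apply: (le_trans (dgB _ _ (lW s s1))); rewrite ler_wpM2l//.
    by apply: (le_trans (fL _ _ W2q W2p)); rewrite ler_wpM2l// norm_le_enorm.
  have lV (s : R) : `|s| <= 1 -> V (line (f p) (f q - f p) s).
    by move=> /lW/W3V.
  apply: (le_trans (chart_rdist gC fK gK fM Mp (AU _ Ap) Mq (AU _ Aq) lV lL)).
  rewrite lee_fin [leLHS]mulrA; apply: ler_wpM2r; first exact: enorm_ge0.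
  by rewrite lerDl.
- move=> c gc c0 c'0 t /andP[t0 t1].
  have cA (s : R) : 0 <= s <= 1 -> A (c s).
    move=> /andP[s0 s1]; apply: rA; rewrite -(subrK (c 0) (c s)) -addrA.
    apply: (le_lt_trans (enormD _ _)).
    have := geodesic_chord gc (lexx 0) s0 s1; rewrite subr0.
    have : s * enorm (derive1 c 0) <= enorm (derive1 c 0).
      by rewrite ler_piMl ?enorm_ge0.
    by move: c0 c'0; lra.
  apply: (chart_acceleration oU oV fC gC fK gK fM F0 L0 G0 AU) => //.
  + by move=> p v [[W1p _] _]; exact: dfF.
  + by move=> p q [[_ ?] _] [[_ ?] _]; exact: fL.
  + by move=> p q v [_ [_ ?]] [_ [_ ?]]; exact: gG.
  + by rewrite t0.
  + have := @near_in_itvoo _ 0 1 t; rewrite in_itv/= t0 t1 => /(_ isT).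
    apply: filterS => s; rewrite in_itv/= => /andP[/ltW s0 /ltW s1].
    by apply: cA; rewrite s0.
- move=> p Mp /lt_trans/(_ r2r)/rA/AU Up; have [Vp gp] := fK _ Up.
  (* The factor pid_mx k restricts the differential to the slice. *)
  have DJ b : 'D_(b *m pid_mx k) g (f p) = b *m (pid_mx k *m jacobian g (f p)).
    by rewrite deriveEjacobian ?mulmxA//; exact: dg.
  exists (pid_mx k *m jacobian g (f p)); split.
    move=> b; rewrite -DJ; apply: (chart_tangent oV gC fK gK fM) => //.
    exact: pid_flat.
  move=> c gc c0p; exists ('D_(derive1 c 0) f p).
  have [c1 _] := geodesic_C2 gc; have [_ Mc _] := gc.
  have Uc0 : U (c 0) by rewrite c0p.
  have [] := chart_velocity oU fC gC fK fM c1 Mc _ Uc0; first by rewrite lexx ler01.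
  rewrite c0p => fl E; rewrite {1}E -DJ; congr ('D__ g (f p)).
  by rewrite flat_pid.
Qed.

End LocalGeometry.

(** * From prox-regularity in M to prox-regularity in Euclidean space *)

Section Comparison.
Variables (R : realType) (n : nat).
Implicit Types (M S U : set 'rV[R]_n) (x y v : 'rV[R]_n) (K s d : R).

Lemma nbhs_enorm x U : nbhs x U ->
  exists2 d : R, 0 < d & forall y, enorm (y - x) < d -> U y.
Proof.
move=> /nbhs_ballP[d /= d0 dU]; exists d => // y yx; apply: dU.
by rewrite -ball_normE/= distrC (le_lt_trans (norm_le_enorm _)).
Qed.

Lemma near_enorm_lt x x0 d : enorm (x - x0) < d ->
  \forall y \near x, enorm (y - x0) < d.
Proof.
move=> xd; have n0 : 0 < n%:R + 1 :> R by rewrite ltr_wpDl.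
have e0 : 0 < (d - enorm (x - x0)) / (n%:R + 1) by rewrite divr_gt0// subr_gt0.
apply: filterS (nbhsx_ballx x _ e0) => y.
rewrite -ball_normE/= distrC ltr_pdivlMr// mulrC => yx.
rewrite -(subrKA x) addrC; apply: (le_lt_trans (enormD _ _)).
have := enorm_le_norm (y - x); have : 0 <= `|y - x| by [].
by move: yx; rewrite mulrDl mul1r; lra.
Qed.

(** The pairings in the two proximal inequalities, with the chord [y - x] and with the
initial velocity, differ by a second order term. *)
Lemma geodesic_dot_bounds M x y c K v : min_geodesic M x y c ->
    (forall t, 0 < t < 1 ->
      enorm (derive1 (derive1 c) t) <= K * enorm (derive1 c 0) ^+ 2) ->
  `|dot v (y - x) - dot v (derive1 c 0)| <=
    enorm v * (K * enorm (derive1 c 0) ^+ 2).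
Proof.
move=> [gc c0 c1 _] cK; have t1 : 0 <= (1 : R) <= 1 by rewrite ler01 lexx.
have T u : dot u (y - x - derive1 c 0) <=
    enorm u * (K * enorm (derive1 c 0) ^+ 2).
  have := geodesic_taylor gc u cK t1.
  by rewrite c0 c1 scale1r mulr1.
rewrite -dotBr ler_norml T andbT lerNl -dotNl.
by have := T (- v); rewrite enormN.
Qed.

(** Close to [x] the Euclidean proximal inequality for [v] and the Taylor estimate give
the one for [vT].  The convex set [U] need not be contained in the neighbourhood where
these apply; at distance at least [dm] from [x], Cauchy-Schwarz gives
[<v, w> <= |v| |w| <= (|v| / dm) |w|^2]. *)
Lemma tangential_part_proximal M S U x v vT K d :
    convex M U -> U x -> within M (nbhs x) U -> tangent M x vT ->
    0 < d -> 0 <= K ->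
    (forall y c, min_geodesic M x y c -> dot vT (derive1 c 0) = dot v (derive1 c 0)) ->
    (forall y c, min_geodesic M x y c -> enorm (derive1 c 0) < d ->
      forall t, 0 < t < 1 ->
        enorm (derive1 (derive1 c) t) <= K * enorm (derive1 c 0) ^+ 2) ->
  proximal_normal setT S x v -> proximal_normal M S x vT.
Proof.
move=> cU Ux nU TvT d0 K0 vvT cK [_ [s [W [s0 _ _ nW Wle]]]].
have /nbhs_enorm[d' d'0 d'W] : nbhs x W.
  have : nbhs x [set y | setT y -> W y] by exact: nW.
  by apply: filterS => y; exact.
split=> //; pose dm := Order.min d d'.
have dm0 : 0 < dm by rewrite lt_min d0.
exists (s + enorm v * K + enorm v / dm), U; split=> //.
  by rewrite -addrA ltr_wpDr// addr_ge0 ?mulr_ge0 ?invr_ge0 ?enorm_ge0// ltW.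
move=> y Uy Sy; have [c mc <-] := inv_expP cU Ux Uy.
rewrite (min_geodesic_rdist mc) -EFin_expe -EFinM lee_fin (vvT _ _ mc).
set w := derive1 c 0 in cK *.
have w2 : 0 <= enorm w ^+ 2 by rewrite exprn_ge0// enorm_ge0.
have vK : 0 <= enorm v * K by rewrite mulr_ge0 ?enorm_ge0.
have vd : 0 <= enorm v / dm by rewrite divr_ge0 ?enorm_ge0 ?ltW.
have [wd|wd] := ltP (enorm w) dm; last first.
  apply: (@le_trans _ _ (enorm v / dm * enorm w ^+ 2)); last first.
    by rewrite ler_wpM2r// lerDr addr_ge0// ltW.
  apply: (le_trans (cauchy_schwarz _ _)); rewrite -mulrA ler_wpM2l ?enorm_ge0//.
  rewrite ler_pdivlMl// expr2 ler_wpM2r ?enorm_ge0//.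
move: wd; rewrite lt_min => /andP[wd wd'].
have yxw : enorm (y - x) <= enorm w.
  by have := enorm_le_rdist M x y; rewrite (min_geodesic_rdist mc) lee_fin.
have := Wle _ (d'W _ (le_lt_trans yxw wd')) Sy.
rewrite inv_exp_setT rdist_setT -EFin_expe -EFinM lee_fin => vyx.
have := geodesic_dot_bounds v mc (cK _ _ mc wd); rewrite -/w ler_norml => /andP[B _].
have sw : s * enorm (y - x) ^+ 2 <= s * enorm w ^+ 2.
  by rewrite ler_wpM2l ?(ltW s0)// ler_pXn2r// ?nnegrE ?enorm_ge0.
have : 0 <= enorm v / dm * enorm w ^+ 2 by rewrite mulr_ge0.
rewrite !mulrDl; move: B vyx sw; rewrite mulrA.
by set X := enorm v * K * _; set Y := enorm v / dm * _; lra.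
Qed.

End Comparison.

Theorem theorem4p3 (R : realType) (n k : nat) (M S : set 'rV[R]_n)
    (hM : submanifold k M) (hMc : complete_submanifold M)
    (hS : closed_in M S) (hS0 : S !=set0)
    (hreg : prox_regular M S) :
  prox_regular setT S.
Proof.
move=> x0 Sx0.
have SM x : S x -> M x by case: hS => D _ -> [].
have [e [s [e0 s0 cU reg]]] := hreg _ Sx0.
have [r [K [C [r0 [K0 C0] rdistC accK tanJ]]]] :=
  submanifold_local_geometry hM (SM _ Sx0).
(* [C d <= e] puts the Euclidean ball of radius [d] into the geodesic ball, and
[2 C d <= r] makes the geodesics between its points short enough for [accK]. *)
pose d := Order.min (Order.min r e) (Order.min (e / C) (r / (2 * C))).
have d0 : 0 < d by rewrite !lt_min r0 e0 !divr_gt0 ?mulr_gt0.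
have dr : d <= r by rewrite /d !ge_min lexx.
have de : d <= e by rewrite /d !ge_min lexx orbT.
have dCe : C * d <= e.
  by rewrite mulrC -ler_pdivlMr// /d !ge_min lexx !orbT.
have dCr : 2 * C * d <= r.
  by rewrite mulrC -ler_pdivlMr ?mulr_gt0// /d !ge_min lexx !orbT.
have x0r : enorm (x0 - x0) < r by rewrite subrr enorm0.
have inU y : M y -> enorm (y - x0) < d -> rball M x0 e y.
  move=> My yd; split=> //.
  apply: (le_lt_trans (rdistC _ _ (SM _ Sx0) My x0r (lt_le_trans yd dr))).
  by rewrite lte_fin (lt_le_trans _ dCe)// ltr_pM2l.
exists d, ((s + e * K) * C ^+ 2); split=> //.
- by rewrite mulr_gt0 ?exprn_gt0// ltr_wpDr// mulr_ge0// ltW.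
- exact: convex_rball_setT.
move=> x y v Sx /rball_setT xd Sy /rball_setT yd pv vd.
have [Mx My] := (SM _ Sx, SM _ Sy).
have [Ux Uy] := (inU _ Mx xd, inU _ My yd).
have xr := lt_le_trans xd dr; have yr := lt_le_trans yd dr.
have [J [tJ JP]] := tanJ _ Mx xr.
have [a aP] := orthogonal_projection J v.
set vT := a *m J in aP.
have vvT z c : min_geodesic M x z c -> dot vT (derive1 c 0) = dot v (derive1 c 0).
  move=> [gc c0 _ _]; have [b ->] := JP _ gc c0.
  by apply/eqP; rewrite eq_sym -subr_eq0 -dotBl aP.
have vTd : enorm vT <= enorm v.
  apply: enorm_le_dot; first exact: enorm_ge0.
  have -> : dot vT vT = dot vT v.
    by apply/eqP; rewrite eq_sym -subr_eq0 -dotBr dotC aP.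
  exact: cauchy_schwarz.
have acc z c : min_geodesic M x z c -> enorm (derive1 c 0) < r ->
    forall t, 0 < t < 1 ->
      enorm (derive1 (derive1 c) t) <= K * enorm (derive1 c 0) ^+ 2.
  by move=> [gc c0 _ _] cr; apply: accK => //; rewrite c0.
have pvT : proximal_normal M S x vT.
  apply: (tangential_part_proximal cU Ux _ (tJ a) r0 K0 vvT acc pv).
  by apply: filterS (near_enorm_lt xd) => z zd Mz; exact: inU.
have [c mc cE] := inv_expP cU Ux Uy.
have := reg _ _ _ Sx Ux Sy Uy pvT (le_lt_trans vTd (lt_le_trans vd de)).
rewrite inv_exp_setT rdist_setT -cE (min_geodesic_rdist mc) -!EFin_expe -!EFinM.
rewrite !lee_fin (vvT _ _ mc).
set w := derive1 c 0 => vw.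
have wC : enorm w <= C * enorm (y - x).
  by have := rdistC _ _ Mx My xr yr; rewrite (min_geodesic_rdist mc) lee_fin.
have wr : enorm w < r.
  apply: (le_lt_trans wC); apply: (lt_le_trans _ dCr).
  rewrite -mulrA mulrCA ltr_pM2l// -(subrKA x0).
  apply: (le_lt_trans (enormD _ _)); rewrite -(enormN (x0 - x)) opprB.
  by move: xd yd; lra.
have := geodesic_dot_bounds v mc (acc _ _ mc wr); rewrite -/w ler_norml => /andP[_ B].
have w2 : enorm w ^+ 2 <= C ^+ 2 * enorm (y - x) ^+ 2.
  by rewrite -exprMn ler_pXn2r// ?nnegrE ?mulr_ge0 ?enorm_ge0 ?ltW.
apply: (@le_trans _ _ ((s + e * K) * enorm w ^+ 2)); last first.
  by rewrite -mulrA ler_wpM2l// addr_ge0 ?mulr_ge0// ltW.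
have : enorm v * (K * enorm w ^+ 2) <= e * (K * enorm w ^+ 2).
  by rewrite ler_wpM2r ?mulr_ge0 ?exprn_ge0 ?enorm_ge0// ltW// (lt_le_trans vd).
rewrite mulrDl -[e * K * _]mulrA; move: B vw.
by set X := K * _; lra.
Qed.
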